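(* Let $k\geqslant 2$ be an integer. (1) For every $\varepsilon>0$ there exists $\delta>0$ such that for every integer $n\geqslant 1$ and all permutations $p_1,\ldots,p_k\in \mathrm{Sym}(n)$ satisfying $d_H(p_ip_jp_i^{-1}p_j^{-1},\mathrm{id}_n)<\delta$ for all $1\leqslant i<j\leqslant k$, there exist pairwise commuting permutations $\tilde p_1,\ldots,\tilde p_k\in \mathrm{Sym}(n)$ such that $d_H(p_i,\tilde p_i)<\varepsilon$ for all $i=1,\ldots,k$. (2) For every $\varepsilon>0$ there exists $\delta>0$ such that for every integer $n\geqslant 1$ and all even permutations $p_1,\ldots,p_k\in \mathrm{Alt}(n)$ satisfying $d_H(p_ip_jp_i^{-1}p_j^{-1},\mathrm{id}_n)<\delta$ for all $1\leqslant i<j\leqslant k$, there exist pairwise commuting even permutations $\tilde p_1,\ldots,\tilde p_k\in \mathrm{Alt}(n)$ such that $d_H(p_i,\tilde p_i)<\varepsilon$ for all $i=1,\ldots,k$.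
   Context: $\mathrm{Sym}(n)$ is the symmetric group on $\{1,\ldots,n\}$, $\mathrm{Alt}(n)$ is its subgroup of even permutations, and $\mathrm{id}_n$ is the identity of $\mathrm{Sym}(n)$. The normalized Hamming distance on $\mathrm{Sym}(n)$ is $d_H(p,q)=\frac1n\,\mathrm{Card}\{i: p(i)\neq q(i)\}$. *)

(* Defs.v *)
From HB Require Import structures.
From mathcomp Require Import all_boot all_order all_algebra all_fingroup.
From mathcomp Require Import all_solvable.
From mathcomp Require Import reals.

Set Implicit Arguments.
Unset Strict Implicit.
Unset Printing Implicit Defensive.

Import GRing.Theory Num.Theory.

Local Open Scope ring_scope.

(* The points are 0, ..., n-1 rather than 1, ..., n.
   The group law of 'S_n composes from left to right: (p * q) x = q (p x).
   The distance from a commutator to 1 does not depend on this convention: the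
   map p \o q \o p^-1 \o q^-1 is (p * q)^-1 * (q * p) in 'S_n, whose inverse is
   conjugate to (p * q) * (q * p)^-1 = p * q * p^-1 * q^-1, so both move the
   same number of points. *)
Definition hamming_dist (R : realType) (n : nat) (p q : 'S_n) : R :=
  #|[set x : 'I_n | p x != q x]|%:R / n%:R.

(* Main.v *)
Require Import Defs.
From HB Require Import structures.
From mathcomp Require Import all_boot all_order all_algebra all_fingroup.
From mathcomp Require Import all_solvable.
From mathcomp Require Import reals.
From mathcomp Require Import zify.

Set Implicit Arguments.
Unset Strict Implicit.
Unset Printing Implicit Defensive.

(* Away from a small set of points, p_1, ..., p_k generate a local action of
   Z^k, and the local stabilizer of a point is constant along its local orbit.
   Reading the stabilizer as a lattice in Hermite normal form, at a scale R such
   that going up to a much larger scale N does not lower any diagonal entry,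
   gives a box with side lengths D_i: the diagonal entry, or N when there is
   none.  The box embeds at the point, and gluing its faces along the rows of
   the matrix (cyclically for the sides N) makes it a quotient of Z^k on which
   the generators disagree with the p_i on a small proportion of points.
   A maximal disjoint family of boxes fills at least 2^-k of the points allowed,
   since boxes that meet have the same shape.  Running through several scales,
   from large to small, and avoiding at each step the region U already filled,
   exhausts almost everything: few small boxes straddle U because U is almost
   invariant.
   All orbits obtained have bounded size.  For even permutations, the signs are
   corrected by trivializing the action on a union of at most 2^k orbits. *)

(** * Words and vectors *)

Section Words.
Variables (k : nat) (X : finType) (p : 'I_k -> {perm X}).

Definition act (w : seq 'I_k) (x : X) : X := foldl (fun y i => p i y) x w.

Lemma act_cat w w' x : act (w ++ w') x = act w' (act w x).
Proof. exact: foldl_cat. Qed.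

Lemma act_inj w : injective (act w).
Proof. by elim: w => [|i w IH] x y //= /IH /perm_inj. Qed.

Lemma actE w x : act w x = (\prod_(i <- w) p i)%g x.
Proof.
elim: w x => [|i w IH] x; first by rewrite big_nil perm1.
by rewrite big_cons permM -IH.
Qed.

Definition noncomm : {set X} :=
  [set x | [exists i, exists j, p i (p j x) != p j (p i x)]].

Fixpoint avoids (Z : {set X}) (r : nat) (x : X) : bool :=
  (x \notin Z) && (if r is r'.+1 then [forall i, avoids Z r' (p i x)] else true).

Lemma avoidsP Z r x w : avoids Z r x -> size w <= r -> act w x \notin Z.
Proof.
elim: w r x => [|i w IH] [|r] x //=; try by case/andP.
by case/andP=> _ /forallP /(_ i) /IH; exact.
Qed.

Lemma avoidsS (Z Z' : {set X}) r x : Z' \subset Z -> avoids Z r x -> avoids Z' r x.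
Proof.
move=> /subsetP sZ; elim: r x => [|r IH] x /= /andP [xZ h].
  by rewrite andbT; apply: contra xZ; apply: sZ.
apply/andP; split; first by apply: contra xZ; apply: sZ.
by apply/forallP => i; apply: IH; apply: (forallP h).
Qed.

(** A point fails at radius [r.+1] if it lies in [Z] or one of its [k] images fails at radius [r].
    Each [p i] is a bijection, so every step multiplies the bound by at most [k.+1]. *)
Lemma card_not_avoids Z r :
  #|[set x | ~~ avoids Z r x]| <= k.+1 ^ r * #|Z|.
Proof.
elim: r => [|r IH].
  by rewrite expn0 mul1n subset_leq_card //; apply/subsetP => x; rewrite !inE /= andbT negbK.
set S := [set x | ~~ avoids Z r x] in IH *.
have sub : [set x | ~~ avoids Z r.+1 x] \subset Z :|: \bigcup_(i < k) (p i @^-1: S).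
  apply/subsetP => x; rewrite !inE /= negb_and negbK.
  case/orP => [-> //|]; rewrite negb_forall => /existsP [i hi].
  by apply/orP; right; apply/bigcupP; exists i => //; rewrite !inE.
apply: leq_trans (subset_leq_card sub) _.
apply: leq_trans (leq_card_setU _ _).1 _.
have hU : #|\bigcup_(i < k) (p i @^-1: S)| <= \sum_(i < k) #|S|.
  elim/big_ind2: _ => [|A a B b hA hB|i _]; first by rewrite cards0.
    by apply: leq_trans (leq_card_setU _ _).1 (leq_add hA hB).
  by rewrite on_card_preimset //; exists (p i)^-1%g => y _; rewrite ?permK ?permKV.
rewrite sum_nat_const card_ord in hU.
have h1 : 0 < k.+1 ^ r by rewrite expn_gt0.
rewrite expnS; nia.
Qed.

Lemma act_rcons_swap r x i w : avoids noncomm r x -> size w <= r ->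
  act (rcons w i) x = act (i :: w) x.
Proof.
move=> g; elim/last_ind: w => [|w j IH] //; rewrite size_rcons => hs.
rewrite -!cats1 -cat1s !act_cat /=.
have := avoidsP g (ltnW hs); rewrite inE negb_exists => /forallP /(_ i).
rewrite negb_exists => /forallP /(_ j); rewrite negbK => /eqP ->.
by rewrite act_cat; congr (p j _); have := IH (ltnW hs); rewrite -cats1 act_cat.
Qed.

(** Each exchange of adjacent letters takes place at a point reached from [x] by a shorter word,
    hence outside [noncomm]. Up to length [r] only the letter counts matter: the [p i] give a
    partial action of N^k at [x]. *)
Lemma act_perm_eq r x w w' : avoids noncomm r x -> size w <= r ->
  perm_eq w w' -> act w x = act w' x.
Proof.
move=> g; elim: w r x w' g => [|i w IH] r x w' g hs.
  by move=> /perm_size /= /esym /size0nil ->.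
move=> pe; have iw' : i \in w' by rewrite -(perm_mem pe) mem_head.
have sz : size w' <= r by rewrite -(perm_size pe).
case/splitPr: iw' pe sz => w1 w2 pe sz.
have pe' : perm_eq w (w1 ++ w2).
  by rewrite -(perm_cons i); apply: perm_trans pe _; rewrite -[i :: w2]cat1s perm_catCA.
rewrite -cat_rcons act_cat (act_rcons_swap i g); last first.
  by apply: leq_trans sz; rewrite size_cat leq_addr.
rewrite -act_cat /=; case: r g hs sz => [|r] //= /andP [_ /forallP g] hs sz.
exact: IH (g i) _ pe'.
Qed.

End Words.

Section Vectors.
Variable k : nat.

(** Exponents are natural numbers, so no inverse letters occur; an integer vector is represented
    later as a difference of two such vectors. *)
Definition word_of (a : 'I_k -> nat) : seq 'I_k :=
  flatten [seq nseq (a i) i | i <- enum 'I_k].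

Lemma count_word_of a j : count_mem j (word_of a) = a j.
Proof.
rewrite count_flatten -map_comp sumnE big_map big_enum /= (bigD1 j) //=.
rewrite count_nseq /= eqxx mul1n big1 ?addn0 // => i /negbTE ne.
by rewrite count_nseq /= ne.
Qed.

Lemma perm_eq_count (w w' : seq 'I_k) :
  (forall i, count_mem i w = count_mem i w') -> perm_eq w w'.
Proof. by move=> h; apply/allP => i _ /=; rewrite h. Qed.

Lemma size_word_of a N : (forall i, a i <= N) -> size (word_of a) <= k * N.
Proof.
move=> h; rewrite size_flatten /shape -map_comp sumnE big_map big_enum /=.
rewrite -[X in X * _](card_ord k) -sum_nat_const leq_sum // => i _.
by rewrite size_nseq.
Qed.

End Vectors.

(** * Stable scales for leading coefficients *)

(* [A R i c] says that a relation of size at most R has leading coefficient c at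
   the coordinate i.  The lemma finds a scale at which the least leading
   coefficients do not change when R is replaced by F R; the bound B does not
   depend on A.  Along failures, the pair (number of coordinates without relation,
   sum of the leading coefficients) decreases lexicographically. *)
Lemma stable_scale (k : nat) (F : nat -> nat) : exists B, forall A : nat -> 'I_k -> nat -> bool,
  (forall R R' i c, R <= R' -> A R i c -> A R' i c) ->
  (forall R i c, A R i c -> 0 < c <= R) ->
  (forall R, R <= F R) ->
  exists R, F R <= B /\ exists d : {ffun 'I_k -> option nat},
    forall i, if d i is Some c then A R i c /\ (forall c', c' < c -> ~~ A (F R) i c')
              else forall c', ~~ A (F R) i c'.
Proof.
pose none (d : {ffun 'I_k -> option nat}) := #|[set i | d i == None]|.
pose tot (d : {ffun 'I_k -> option nat}) := \sum_i odflt 0 (d i).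
pose good_bound m s R B := forall A : nat -> 'I_k -> nat -> bool,
  (forall R R' i c, R <= R' -> A R i c -> A R' i c) ->
  (forall R i c, A R i c -> 0 < c <= R) ->
  (forall R, R <= F R) -> forall d, none d <= m -> tot d <= s ->
  (forall i c, d i = Some c -> A R i c) ->
  exists R, F R <= B /\ exists d : {ffun 'I_k -> option nat},
    forall i, if d i is Some c then A R i c /\ (forall c', c' < c -> ~~ A (F R) i c')
              else forall c', ~~ A (F R) i c'.
suff main m s R : exists B, good_bound m s R B.
  have [B hB] := main k 0 0; exists B => A h1 h2 h3.
  apply: (hB A h1 h2 h3 [ffun => None]) => [||i c]; last by rewrite ffunE.
    by rewrite /none -[X in _ <= X]card_ord max_card.
  by rewrite /tot big1 // => i _; rewrite ffunE.
elim/ltn_ind: m s R => m IHm s; elim/ltn_ind: s => s IHs R.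
(* If scale [R] fails for [d], the search restarts at [F R]. A first relation at a coordinate lowers
   [none] and adds at most [F R] to [tot]; a smaller coefficient lowers [tot] without raising
   [none]. [B1] and [B2] bound the search in these two cases. *)
have [B1 hB1] : exists B1, 0 < m -> good_bound m.-1 (s + F R) (F R) B1.
  case: m IHm {IHs} => [|m] IHm; first by exists 0.
  by have [B hB] := IHm m (ltnSn m) (s + F R) (F R); exists B.
have [B2 hB2] : exists B2, 0 < s -> good_bound m s.-1 (F R) B2.
  case: s IHs {hB1} => [|s] IHs; first by exists 0.
  by have [B hB] := IHs s (ltnSn s) (F R); exists B.
exists (F R + B1 + B2) => A hm hc hF d hn ht hr.
case: (boolP [exists i, exists c : 'I_(F R).+1, A (F R) i c && 
    (if d i is Some c0 then c < c0 else true)]) => [|/existsPn min_d]; last first.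
  exists R; split; first by rewrite -addnA leq_addr.
  exists d => i; have := min_d i; rewrite negb_exists => /forallP h.
  have h' c : (if d i is Some c0 then c < c0 else true) -> ~~ A (F R) i c.
    move=> hd; apply/negP => a; have /andP [_ le] := hc _ _ _ a.
    by have := h (Ordinal (le : c < (F R).+1)); rewrite /= a hd.
  by case e: (d i) h' => [c0|] h'; [split=> [|c]; [exact: hr | exact: h'] | move=> c; exact: h'].
case/existsP=> i /existsP [[c cF]] /= /andP [Ac dc].
pose d' : {ffun 'I_k -> option nat} := [ffun j => if j == i then Some c else d j].
have hr' j c' : d' j = Some c' -> A (F R) j c'.
  by rewrite ffunE; case: eqP => [-> [<-]|_ /hr] //; apply: hm.
have tot_d' : tot d' + odflt 0 (d i) = tot d + c.
  rewrite /tot (bigD1 i) //= [X in _ = X + _](bigD1 i) //= ffunE eqxx /=.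
  rewrite (eq_bigr (fun j => odflt 0 (d j))) => [|j /negbTE ne]; last by rewrite ffunE ne.
  by rewrite addnC [c + _]addnC addnA.
case e: (d i) dc tot_d' => [c0|] /= dc tot_d'.
  have s0 : 0 < s.
    by apply: leq_trans ht; rewrite /tot (bigD1 i) //= e /=; lia.
  have nn : none d' <= m.
    apply: leq_trans hn; apply/subset_leq_card/subsetP => j; rewrite !inE ffunE.
    by case: (j == i).
  have [|R' [le ok]] := hB2 s0 A hm hc hF d' nn _ hr'; first lia.
  by exists R'; split=> //; lia.
have nn : none d = (none d').+1.
  rewrite /none (cardsD1 i) inE e eqxx add1n; congr _.+1.
  by apply: eq_card => j; rewrite !inE ffunE; case: (j == i).
have m0 : 0 < m by lia.
have [||R' [le ok]] := hB1 m0 A hm hc hF d' _ _ hr'; try lia.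
by exists R'; split=> //; lia.
Qed.


(** * Boxes *)

(** Union bound along the word: a discrepancy first arises at some letter, at a point of [M], and
    pulling [M] back by a permutation preserves its size. *)
Lemma card_mismatch_along (k : nat) (X T : finType) (p : 'I_k -> {perm X})
    (t : 'I_k -> {perm T}) (f : T -> X) (M : {set T}) (w : seq 'I_k) :
  (forall j b, j \in w -> b \notin M -> f (t j b) = p j (f b)) ->
  #|[set b | f (act t w b) != act p w (f b)]| <= size w * #|M|.
Proof.
elim: w => [|j w IH] h.
  by rewrite (_ : [set _ | _] = set0) ?cards0 //; apply/setP => b; rewrite !inE /= eqxx.
set S := [set b | f (act t w b) != act p w (f b)] in IH.
have sub : [set b | f (act t (j :: w) b) != act p (j :: w) (f b)] \subset M :|: t j @^-1: S.
  apply/subsetP => b; rewrite !inE /=; case: (boolP (b \in M)) => //= bM.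
  by rewrite -h ?mem_head.
apply: leq_trans (subset_leq_card sub) _.
apply: leq_trans (leq_card_setU _ _).1 _.
rewrite on_card_preimset; last first.
  by exists (t j)^-1%g => y _; rewrite ?permK ?permKV.
rewrite mulSn leq_add2l IH // => l b lw; apply: h.
by rewrite inE lw orbT.
Qed.

(** * Adjoining a root to a commuting family *)

Section RootExtension.
Variables (T : finType) (e : nat) (u : {perm T}).

Definition lift_fun (s : {perm T}) (bs : T * 'I_e.+1) := (s bs.1, bs.2).

Lemma lift_fun_inj s : injective (lift_fun s).
Proof. by case=> b1 s1 [b2 s2] [/perm_inj -> ->]. Qed.

Definition lift_perm_pair s := perm (@lift_fun_inj s).

(* [root_perm] is an (e+1)-th root of u acting on the first factor. *)
Definition root_fun (bs : T * 'I_e.+1) :=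
  if bs.2 == ord_max then (u bs.1, ord0) else (bs.1, inord bs.2.+1 : 'I_e.+1).

Lemma root_fun_inj : injective root_fun.
Proof.
have lt (s : 'I_e.+1) : s != ord_max -> s.+1 < e.+1.
  by move=> ne; rewrite ltnS ltn_neqAle -ltnS ltn_ord andbT.
case=> b1 s1 [b2 s2]; rewrite /root_fun /=.
case: ifPn => [/eqP ->|n1]; case: ifPn => [/eqP ->|n2] [].
- by move=> /perm_inj ->.
- by move=> _ /(congr1 val); rewrite /= inordK ?lt.
- by move=> _ /(congr1 val); rewrite /= inordK ?lt.
- by move=> -> /(congr1 val); rewrite /= !inordK ?lt // => -[] /val_inj ->.
Qed.

Definition root_perm := perm root_fun_inj.

Lemma lift_perm_pair_commute s s' : commute s s' ->
  commute (lift_perm_pair s) (lift_perm_pair s').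
Proof.
move=> c; apply/permP => -[b r]; rewrite !permM !permE /lift_fun /=.
by rewrite -!permM c.
Qed.

Lemma root_lift_commute s : commute u s -> commute root_perm (lift_perm_pair s).
Proof.
move=> c; apply/permP => -[b r]; rewrite !permM !permE /lift_fun /root_fun /=.
by case: ifP => //= _; rewrite -!permM c.
Qed.

End RootExtension.

(** * Charts: commuting models of a box *)

Section Chart.
Variables (k : nat) (X : finType) (p : 'I_k -> {perm X}) (x : X).

Definition chart_map (T : Type) (v : T -> {ffun 'I_k -> nat}) (b : T) : X :=
  act p (word_of (v b)) x.

Definition chart_mismatch (T : finType) (i : nat) (t : 'I_k -> {perm T})
    (v : T -> {ffun 'I_k -> nat}) : {set T} :=
  [set b | [exists j : 'I_k, (j < i) && (chart_map v (t j b) != p j (chart_map v b))]].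

(** [T] models the box spanned by the first [i] coordinates; [v] gives the coordinates of its
    points, zero from [i] on. The [t j] commute exactly; their failure to follow [p] is counted
    separately by [chart_mismatch], for [j < i]. *)
Definition is_chart (i : nat) (D : 'I_k -> nat) (T : finType) (t : 'I_k -> {perm T})
    (v : T -> {ffun 'I_k -> nat}) : Prop :=
  [/\ forall j l, commute (t j) (t l),
      #|T| = \prod_(l < k | l < i) D l,
      injective v
    & forall b l, v b l < if l < i then D l else 1].

Variables (N r : nat).
Hypothesis x_good : avoids p (noncomm p) r x.

(** [D i] copies of [T] are stacked in direction [i]. The new generator climbs one layer and returns
    from the top through [u], so it commutes with the old generators. Each layer repeats the old
    mismatches, and the top one adds those where [u] differs from the [D i]-th iterate of [p i]. *)
Lemma chart_extend (D : 'I_k -> nat) (i : 'I_k) (T : finType) (t : 'I_k -> {perm T}) v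
    (u : {perm T}) (m2 : nat) :
  k * N + N + 1 <= r -> (forall l, 0 < D l <= N) ->
  is_chart i D t v -> (forall j, commute u (t j)) ->
  #|[set b | iter (D i) (p i) (chart_map v b) != chart_map v (u b)]| <= m2 ->
  exists (T' : finType) (t' : 'I_k -> {perm T'}) (v' : T' -> {ffun 'I_k -> nat}),
    is_chart i.+1 D t' v' /\
    #|chart_mismatch i.+1 t' v'| <= D i * #|chart_mismatch i t v| + m2.
Proof.
move=> r_big D_bnd [t_comm cardT v_inj v_box] u_comm.
have [e De] : exists e, D i = e.+1 by case: (D i) (D_bnd i) => // e; exists e.
rewrite De; set M2 := [set b | _] => hM2.
pose v' (bs : T * 'I_e.+1) : {ffun 'I_k -> nat} :=
  [ffun l => if l == i then nat_of_ord bs.2 else v bs.1 l].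
pose t' j := if j == i then root_perm e u else lift_perm_pair e (t j).
have v_i b : v b i = 0 by have := v_box b i; rewrite ltnn; case: (v b i).
have size_v b n : n <= N + 1 -> size (word_of (v b)) + n <= r.
  move=> n_le; apply: leq_trans r_big; rewrite -addnA leq_add // size_word_of // => l.
  by have := v_box b l; have := D_bnd l; case: ifP => _; lia.
(* The point over [b] in layer [s] is reached by the word of [v b] followed by [s] letters [i];
   commutation up to length [r] allows this reordering. *)
have map_v' b s w : size w <= 1 ->
    act p w (chart_map v' (b, s)) = act p (word_of (v b) ++ nseq s i ++ w) x.
  move=> w1; rewrite /chart_map -act_cat; symmetry; apply: act_perm_eq x_good _ _.
    rewrite !size_cat size_nseq; apply: size_v; rewrite leq_add //.
    by apply: leq_trans (ltnW (ltn_ord s)) _; rewrite -De; have /andP [] := D_bnd i.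
  apply: perm_eq_count => l; rewrite !count_cat !count_word_of ffunE /= count_nseq /=.
  rewrite addnA; congr (_ + _); rewrite eq_sym.
  by case: eqP => [->|_]; rewrite ?v_i ?mul1n // mul0n addn0.
exists (T * 'I_e.+1)%type, t', v'; split.
  split.
  - move=> j l; rewrite /t'; case: ifP => _; case: ifP => _ //.
    + exact: root_lift_commute.
    + by apply: commute_sym; apply: root_lift_commute.
    + exact: lift_perm_pair_commute.
  - rewrite card_prod card_ord cardT [RHS](bigD1 i) //= De mulnC; congr (_ * _).
    by apply: eq_bigl => l; rewrite ltnS [RHS]andbC -val_eqE /= -ltn_neqAle.
  - case=> b s [b' s'] /ffunP eqv.
    have := eqv i; rewrite !ffunE eqxx /= => /val_inj ->; congr (_, _).
    apply: v_inj; apply/ffunP => l; have := eqv l; rewrite !ffunE /=.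
    by case: eqP => [->|//]; rewrite !v_i.
  - case=> b s l; rewrite ffunE ltnS /=; case: eqP => [->|/eqP ne].
      by rewrite leqnn De.
    by have := v_box b l; rewrite [l <= i]leq_eqVlt val_eqE (negbTE ne).
set M := chart_mismatch i t v.
have sub : chart_mismatch i.+1 t' v' \subset
    setX M setT :|: setX M2 [set ord_max].
  apply/subsetP => -[b s]; rewrite !inE andbT; apply: contraLR.
  rewrite negb_or negb_and => /andP [bM h2].
  rewrite negb_exists; apply/forallP => j; rewrite negb_and negbK ltnS.
  case: (ltngtP j i) => //= [ji|/val_inj ->].
    have ne : (j == i) = false by rewrite -val_eqE /= ltn_eqF.
    have {}bM : chart_map v (t j b) = p j (chart_map v b).
      move: bM; rewrite negb_exists => /forallP /(_ j).
      by rewrite ji negbK => /eqP.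
    rewrite /t' ne permE /lift_fun /=; apply/eqP.
    rewrite -[LHS]/(act p [::] _) -[RHS]/(act p [:: j] _) !map_v' // cats0.
    have -> : act p (word_of (v b) ++ nseq s i ++ [:: j]) x =
              act p (word_of (v b) ++ [:: j] ++ nseq s i) x.
      apply: act_perm_eq x_good _ _; last by rewrite perm_cat2l perm_catC.
      rewrite !size_cat size_nseq; apply: size_v; rewrite leq_add //.
      by apply: leq_trans (ltnW (ltn_ord s)) _; rewrite -De; have /andP [] := D_bnd i.
    by rewrite catA !act_cat -/(chart_map v b) /= -bM.
  rewrite /t' eqxx permE /root_fun /=.
  rewrite -[X in X == _]/(act p [::] _) -[p i _]/(act p [:: i] _).
  have iter_act n y : act p (nseq n i) y = iter n (p i) y.
    by elim: n y => //= n IH y; rewrite IH -iterSr.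
  case: ifPn h2 => [/eqP -> h2|ne _]; rewrite !map_v' // cats0.
    move: h2; rewrite orbF negbK => /eqP h2.
    rewrite cats0 -/(chart_map v (u b)) -h2 act_cat -/(chart_map v b).
    by rewrite act_cat iter_act.
  rewrite inordK; last by rewrite ltnS ltn_neqAle -ltnS ltn_ord andbT.
  by rewrite !act_cat !iter_act.
apply: leq_trans (subset_leq_card sub) _; apply: leq_trans (leq_card_setU _ _).1 _.
by rewrite !cardsX cardsT card_ord cards1 muln1 mulnC leq_add2l.
Qed.
End Chart.

Section ChartExistence.
Variables (k : nat) (X : finType) (p : 'I_k -> {perm X}) (x : X).

(** For [c > 0], [a - b] is a vector of the local stabilizer whose last nonzero coordinate is [i],
    with value [c]: the shape of a row of a Hermite normal form. *)
Definition relation_at (R : nat) (i : 'I_k) (c : nat) : Prop :=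
  exists a b : 'I_k -> nat,
    [/\ forall l, a l <= R /\ b l <= R,
        forall l : 'I_k, i < l -> a l = b l,
        a i = b i + c
      & act p (word_of a) x = act p (word_of b) x].

(** Divided by [N], this bounds the proportion of mismatches in a chart. The factor [2 * k * R]
    comes from the two words of a relation, the added 1 from a cyclic side of length [N]. *)
Fixpoint chart_const (R i : nat) : nat :=
  if i is i'.+1 then (1 + 2 * k * R) * chart_const R i' + 1 else 1.

Variables (N r : nat).
Hypothesis x_good : avoids p (noncomm p) r x.

(** Solving the relation for coordinate [i] expresses the [D i]-th iterate of [p i] through the
    coordinates below [i]. So [u] is the inverse of the product of the [t j] along the lower part of
    [a], times the product along that of [b]. It commutes with every [t j] and errs only where one
    of these words, of length at most [k * R], does. *)
Lemma relation_root (D : 'I_k -> nat) (R : nat) (i : 'I_k) (T : finType)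
    (t : 'I_k -> {perm T}) v :
  k * N + k * R <= r -> (forall l, 0 < D l <= N) ->
  is_chart i D t v -> relation_at R i (D i) ->
  exists u : {perm T}, (forall j, commute u (t j)) /\
    #|[set b | iter (D i) (p i) (chart_map p x v b) != chart_map p x v (u b)]|
      <= 2 * k * R * #|chart_mismatch p x i t v|.
Proof.
move=> r_big D_bnd [t_comm cardT v_inj v_box] [a [b [ab_le ab_gt ab_i rel]]].
pose low (c : 'I_k -> nat) (l : 'I_k) := if l < i then c l else 0.
pose wa := word_of (low a); pose wb := word_of (low b).
pose wc := word_of (fun l : 'I_k => if l < i then 0 else b l).
have low_le c : (forall l, c l <= R) -> size (word_of (low c)) <= k * R.
  by move=> h; apply: size_word_of => l; rewrite /low; case: ifP.
have size_v b' : size (word_of (v b')) <= k * N.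
  apply: size_word_of => l; have := v_box b' l; have := D_bnd l.
  by case: ifP => _; lia.
have mem_low c l : l \in word_of (low c) -> l < i.
  by rewrite -has_pred1 has_count count_word_of /low; case: ifP.
(* The relation is translated from [x] to the chart point of [z]. The word [wc] carries the
   exponents of [b] from [i] on, common to both sides, and is cancelled by injectivity. *)
have rel_shift z : act p (word_of (v z) ++ wa ++ nseq (D i) i) x =
                   act p (word_of (v z) ++ wb) x.
  apply: (@act_inj _ _ p wc); rewrite -!act_cat.
  have -> : act p ((word_of (v z) ++ wa ++ nseq (D i) i) ++ wc) x =
            act p (word_of a ++ word_of (v z)) x.
    symmetry; apply: act_perm_eq x_good _ _.
      rewrite size_cat addnC; apply: leq_trans r_big; apply: leq_add (size_v _) _.
      by apply: size_word_of => l; have [] := ab_le l.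
    apply: perm_eq_count => l; rewrite !count_cat !count_word_of count_nseq /= /low.
    rewrite addnC -!addnA; congr (_ + _); rewrite eq_sym.
    case: (ltngtP l i) => [li|il|/val_inj ->].
    - by rewrite -val_eqE /= (ltn_eqF li) !addn0.
    - by rewrite -val_eqE /= (gtn_eqF il) ab_gt.
    - by rewrite eqxx mul1n ab_i addnC.
  have -> : act p ((word_of (v z) ++ wb) ++ wc) x =
            act p (word_of b ++ word_of (v z)) x.
    symmetry; apply: act_perm_eq x_good _ _.
      rewrite size_cat addnC; apply: leq_trans r_big; apply: leq_add (size_v _) _.
      by apply: size_word_of => l; have [] := ab_le l.
    apply: perm_eq_count => l; rewrite !count_cat !count_word_of /low.
    by rewrite addnC -!addnA; congr (_ + _); case: ifP; rewrite ?addn0.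
  by rewrite !act_cat rel.
pose Pa := (\prod_(j <- wa) t j)%g; pose Pb := (\prod_(j <- wb) t j)%g.
have comm_prod w j : commute (t j) (\prod_(l <- w) t l)%g.
  by elim/big_rec: _ => [|l y _ c]; [exact: commute1 | exact: commuteM].
exists (Pa^-1 * Pb)%g; split=> [j|].
  by apply/commute_sym/commuteM; [apply: commuteV|]; apply: comm_prod.
set M := chart_mismatch _ _ _ _ _.
pose Bad w := [set c | chart_map p x v (act t w c) != act p w (chart_map p x v c)].
have card_Bad c : (forall l, c l <= R) -> #|Bad (word_of (low c))| <= k * R * #|M|.
  move=> hc; apply: leq_trans (card_mismatch_along (M := M) _) _.
    move=> j y /mem_low ji; rewrite inE negb_exists => /forallP /(_ j).
    by rewrite ji negbK => /eqP.
  by rewrite leq_mul2r low_le ?orbT.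
set M2 := [set _ | _].
(* From [Pa^-1 y] the word [wa] leads to [y], and [wb] leads to the image of [y] under [u]. *)
have sub : M2 \subset Pa @: (Bad wa :|: Bad wb).
  apply/subsetP => y; rewrite inE => hy.
  apply/imsetP; exists (Pa^-1%g y); last by rewrite permKV.
  apply: contraR hy; rewrite !inE negb_or !negbK => /andP [/eqP ha /eqP hb].
  have iter_act n z : act p (nseq n i) z = iter n (p i) z.
    by elim: n z => //= n IH z; rewrite IH -iterSr.
  rewrite permM -(iter_act (D i)) /Pb -actE hb -[in X in X == _](permKV Pa y).
  by rewrite {1}/Pa -actE ha /chart_map -!act_cat rel_shift.
apply: leq_trans (subset_leq_card sub) _.
rewrite card_imset; last exact: perm_inj.
apply: leq_trans (leq_card_setU _ _).1 _.
have -> : 2 * k * R * #|M| = k * R * #|M| + k * R * #|M| by lia.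
by apply: leq_add; apply: card_Bad => l; have [] := ab_le l.
Qed.

Lemma chart_exists (D : 'I_k -> nat) (R i : nat) :
  k * N + k * R + N + 1 <= r -> (forall l, 0 < D l <= N) ->
  (forall l, D l = N \/ relation_at R l (D l)) -> i <= k ->
  exists (T : finType) (t : 'I_k -> {perm T}) (v : T -> {ffun 'I_k -> nat}),
    is_chart i D t v /\ N * #|chart_mismatch p x i t v| <= chart_const R i * #|T|.
Proof.
move=> r_big D_bnd D_rel; elim: i => [|i IH] ik.
  exists unit, (fun _ => 1%g), (fun _ => [ffun => 0]); split.
    split=> [j l||[] [] //|b l]; last by rewrite ffunE.
    - exact: commute1.
    - by rewrite card_unit big1.
  rewrite (_ : chart_mismatch _ _ _ _ _ = set0) ?cards0 ?muln0 //.
  by apply/setP => b; rewrite !inE; apply/negbTE/existsPn => j; rewrite ltn0.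
have [T [t [v [chT hT]]]] := IH (ltnW ik).
pose i0 := Ordinal ik; set M := chart_mismatch _ _ _ _ _ in hT.
(* A side of length [N] is closed cyclically by [u = 1], and its whole top layer, a proportion
   [1/N], is given up as mismatch. The other sides use their relation. *)
have [u [m2 [uc hm2 m2le]]] : exists (u : {perm T}) m2, [/\ forall j, commute u (t j),
    #|[set b | iter (D i0) (p i0) (chart_map p x v b) != chart_map p x v (u b)]| <= m2
  & N * m2 <= D i0 * #|T| + 2 * k * R * (N * #|M|)].
  have [DN|rel] := D_rel i0.
    exists 1%g, #|T|; split=> [j||]; [exact/commute_sym/commute1 | exact: max_card|].
    by rewrite DN leq_addr.
  have [|u [uc hu]] := @relation_root D R i0 T t v _ D_bnd chT rel; first by lia.
  exists u, (2 * k * R * #|M|); split=> //.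
  by rewrite mulnCA leq_addl.
have [|T' [t' [v' [chT' hT']]]] := @chart_extend _ _ _ _ N r x_good D i0 T t v u m2 _ D_bnd chT uc hm2.
  by lia.
exists T', t', v'; split=> //.
have cT' : #|T'| = D i0 * #|T|.
  have [_ -> _ _] := chT; have [_ -> _ _] := chT'; rewrite (bigD1 i0) //=; congr (_ * _).
  by apply: eq_bigl => l; rewrite ltnS andbC -val_eqE /= -ltn_neqAle.
have /andP [D0 _] := D_bnd i0.
rewrite -/M in hT' *; rewrite cT' /=.
apply: leq_trans (leq_mul (leqnn N) hT') _.
rewrite mulnDr; move: m2le hT; set A := N * m2; set C := chart_const R i.
move: #|M| #|T| (D i0) D0 => m c d d0 h1 h2.
have h3 : d * (N * m) <= d * (C * c) by rewrite leq_mul2l h2 orbT.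
have h4 : 2 * k * R * (N * m) <= d * (2 * k * R * (C * c)).
  apply: leq_trans (leq_mul (leqnn _) h2) _; exact: leq_pmull.
have -> : ((1 + 2 * k * R) * C + 1) * (d * c) = d * (C * c) + (d * c + d * (2 * k * R * (C * c))) by lia.
rewrite mulnCA; apply: leq_add => //; lia.
Qed.
End ChartExistence.

(** * Transport and gluing of permutations *)

Lemma transport_perm (T X : finType) (f : T -> X) (s : {perm T}) : injective f ->
  exists q : {perm X}, (forall b, q (f b) = f (s b)) /\
    (forall z, z \notin codom f -> q z = z).
Proof.
move=> f_inj.
pose g (s : {perm T}) z := if [pick b | f b == z] is Some b then f (s b) else z.
have gf s' b : g s' (f b) = f (s' b).
  by rewrite /g; case: pickP => [c /eqP /f_inj -> //|/(_ b)]; rewrite eqxx.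
have gn s' z : z \notin codom f -> g s' z = z.
  by rewrite /g; case: pickP => // b /eqP <-; rewrite codom_f.
have gK : cancel (g s) (g s^-1%g).
  move=> z; case: (boolP (z \in codom f)) => [/codomP [b ->]|h]; last by rewrite !gn ?gn.
  by rewrite !gf permK.
exists (perm (can_inj gK)); split=> [b|z h]; rewrite permE; [exact: gf | exact: gn].
Qed.

Lemma glue_perms (k : nat) (I X : finType) (Y : {set I}) (tile : I -> {set X})
    (qq : I -> 'I_k -> {perm X}) :
  {in Y &, forall y y', y != y' -> [disjoint tile y & tile y']} ->
  {in Y, forall y j, perm_on (tile y) (qq y j)} ->
  {in Y, forall y i j, commute (qq y i) (qq y j)} ->
  exists Q : 'I_k -> {perm X},
    [/\ forall i j, commute (Q i) (Q j),
        {in Y, forall y j, {in tile y, Q j =1 qq y j}}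
      & forall z j, (forall y, y \in Y -> z \notin tile y) -> Q j z = z].
Proof.
move=> disj on comm.
pose own z := [pick y in Y | z \in tile y].
have ownE y z : y \in Y -> z \in tile y -> own z = Some y.
  move=> yY zy; rewrite /own; case: pickP => [y' /andP [y'Y zy']|/(_ y)]; last by rewrite yY zy.
  case: (eqVneq y' y) => [-> //|/(disj _ _ y'Y yY)].
  by rewrite disjoint_subset => /subsetP /(_ _ zy'); rewrite inE zy.
have ownN z : (forall y, y \in Y -> z \notin tile y) -> own z = None.
  by move=> h; rewrite /own; case: pickP => // y /andP [/h /negbTE ->].
have ownP z : (exists2 y, y \in Y & z \in tile y) \/ (forall y, y \in Y -> z \notin tile y).
  case: (boolP [exists y in Y, z \in tile y]) => [/exists_inP [y]|/exists_inPn]; last by right.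
  by left; exists y.
pose g (s : I -> {perm X}) z := if own z is Some y then s y z else z.
have gin s y z : y \in Y -> z \in tile y -> g s z = s y z.
  by move=> yY zy; rewrite /g (ownE y).
have gout s z : (forall y, y \in Y -> z \notin tile y) -> g s z = z.
  by move=> h; rewrite /g ownN.
have gK j : cancel (g (fun y => qq y j)) (g (fun y => (qq y j)^-1%g)).
  move=> z; have [[y yY zy]|h] := ownP z; last by rewrite !gout ?gout.
  by rewrite !(gin _ y) ?permK // (perm_closed _ (on y yY j)).
exists (fun j => perm (can_inj (gK j))); split.
- move=> i j; apply/permP => z; rewrite !permM !permE.
  have [[y yY zy]|h] := ownP z; last by rewrite !gout.
  rewrite !(gin _ y) ?(perm_closed _ (on y yY _)) //.
  by rewrite -!permM (comm y yY).
- by move=> y yY j z zy; rewrite permE (gin _ y).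
- by move=> z j h; rewrite permE gout.
Qed.

(** * Tiles: boxes embedded in [X] *)

Section Tiles.
Variables (k : nat) (X : finType) (p : 'I_k -> {perm X}).

(** The cardinality forces [C] to be the full image of the box at [x], embedded injectively. *)
Definition tile_of (D : 'I_k -> nat) (x : X) (C : {set X}) : Prop :=
  #|C| = \prod_l D l /\
  (forall z, z \in C -> exists a : 'I_k -> nat,
     (forall l, a l < D l) /\ z = act p (word_of a) x).

(** At the largest coordinate where two vectors differ, a coincidence of images yields a relation
    with leading coefficient strictly between 0 and the side length, which is excluded. *)
Lemma box_inj (D : 'I_k -> nat) N x :
  (forall l, D l <= N) ->
  (forall l c, 0 < c < D l -> ~ relation_at p x N l c) ->
  forall a b : 'I_k -> nat, (forall l, a l < D l) -> (forall l, b l < D l) ->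
    act p (word_of a) x = act p (word_of b) x -> a =1 b.
Proof.
move=> D_le no_rel a b ha hb eq_ab l0; apply/eqP; apply: contraT => ne0.
pose i := [arg max_(l > l0 | a l != b l) (l : nat)].
have [ne top] : a i != b i /\ forall l : 'I_k, i < l -> a l = b l.
  rewrite /i; case: arg_maxnP => // l ne hl; split=> // l' ll'.
  by apply/eqP; apply: contraT => /hl /=; rewrite leqNgt ll'.
have le (c : 'I_k -> nat) : (forall l, c l < D l) -> forall l, c l <= N.
  by move=> hc l; apply: leq_trans (ltnW (hc l)) (D_le l).
have ai := ha i; have bi := hb i.
case: (ltngtP (a i) (b i)) ne => // lt _.
- case: (no_rel i (b i - a i)); first by lia.
  exists b, a; split=> //; last by lia.
  + by move=> l; split; apply: le.
  + by move=> l /top.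
- case: (no_rel i (a i - b i)); first by lia.
  exists a, b; split=> //; last by lia.
  by move=> l; split; apply: le.
Qed.

(** Relations of size [R] close up the chart, and the absence of smaller leading coefficients at
    size [N] makes it embed. The commuting model is then transported to [X] and extended by the
    identity. *)
Lemma tile_exists (D : 'I_k -> nat) (R N r : nat) x :
  avoids p (noncomm p) r x -> k * N + k * R + N + 1 <= r ->
  (forall l, 0 < D l <= N) ->
  (forall l, D l = N \/ relation_at p x R l (D l)) ->
  (forall l c, 0 < c < D l -> ~ relation_at p x N l c) ->
  exists (C : {set X}) (q : {ffun 'I_k -> {perm X}}),
    [/\ tile_of D x C, forall i j, commute (q i) (q j), forall j, perm_on C (q j)
      & N * #|[set z in C | [exists j, q j z != p j z]]| <= chart_const k R k * #|C|].
Proof.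
move=> x_good r_big D_bnd D_rel no_rel.
have [T [t [v [[t_comm cardT v_inj v_box] mis]]]] :=
  chart_exists x_good r_big D_bnd D_rel (leqnn k).
set f := chart_map p x v.
have box b l : v b l < D l by have := v_box b l; rewrite ltn_ord.
have f_inj : injective f.
  move=> b b' /(box_inj (fun l => (andP (D_bnd l)).2) no_rel (box b) (box b')) h.
  by apply: v_inj; apply/ffunP.
have /fin_all_exists [q hq] := fun j => transport_perm (t j) f_inj.
have card_C : #|f @: setT| = #|T| by rewrite card_imset // cardsT.
exists (f @: setT), [ffun j => q j]; split.
- split; first by rewrite card_C cardT; apply: eq_bigl => l; rewrite ltn_ord.
  by move=> z /imsetP [b _ ->]; exists (v b).
- move=> i j; apply/permP => z; rewrite !permM !ffunE.
  case: (boolP (z \in codom f)) => [/codomP [b ->]|h].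
    by rewrite !(hq _).1 -!permM t_comm.
  by rewrite !(hq _).2 // ?(hq _).2.
- move=> j; apply/subsetP => z; rewrite inE ffunE; apply: contraR => h.
  rewrite (hq j).2 //; apply: contra h => /codomP [b ->]; exact: imset_f.
rewrite card_C; apply: leq_trans _ mis; rewrite leq_mul2l; apply/orP; right.
rewrite -(card_imset _ f_inj); apply: subset_leq_card; apply/subsetP => z.
rewrite inE => /andP [/imsetP [b _ ->] /existsP [j]]; rewrite ffunE (hq j).1 => ne.
by apply: imset_f; rewrite inE; apply/existsP; exists j; rewrite ltn_ord.
Qed.

Lemma card_meeting (D : 'I_k -> nat) (N r : nat) y (Z : {set X}) :
  k * N <= r -> (forall l, D l <= N) -> avoids p (noncomm p) r y ->
  (forall x, x \in Z -> avoids p (noncomm p) r x /\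
     exists a b : 'I_k -> nat, [/\ forall l, a l < D l, forall l, b l < D l &
       act p (word_of a) x = act p (word_of b) y]) ->
  #|Z| <= 2 ^ k * \prod_l D l.
Proof.
move=> r_big D_le y_good hZ.
pose code := ({ffun 'I_k -> bool} * {dffun forall l : 'I_k, 'I_(D l)})%type.
(* A coincidence [a . x = b . y] simplifies to the positive and negative parts of
   a - b, which are determined by |a - b| and a sign pattern. *)
pose sel (s : bool) (c : code) (l : 'I_k) : nat := if c.1 l == s then nat_of_ord (c.2 l) else 0.
have [dec hdec] : exists dec : code -> X, forall c x,
    act p (word_of (sel true c)) x = act p (word_of (sel false c)) y -> dec c = x.
  exists (fun c => (\prod_(i <- word_of (sel true c)) p i)^-1%g (act p (word_of (sel false c)) y)).
  by move=> c x <-; rewrite actE permK.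
have sub : Z \subset dec @: setT.
  apply/subsetP => x /hZ [x_good [a [b [ha hb eq_ab]]]].
  have lt l : (if b l <= a l then a l - b l else b l - a l) < D l.
    by have := ha l; have := hb l; case: ifP; lia.
  pose c : code := ([ffun l => b l <= a l],
    [ffun l => Ordinal (lt l)] : {dffun forall l : 'I_k, 'I_(D l)}).
  apply/imsetP; exists c => //; apply/esym/hdec.
  pose m l := minn (a l) (b l).
  have split_word (w w' : 'I_k -> nat) z : avoids p (noncomm p) r z ->
      (forall l, w l = m l + w' l) -> (forall l, w l <= N) ->
      act p (word_of w) z = act p (word_of m) (act p (word_of w') z).
    move=> g e le; rewrite -act_cat; apply: act_perm_eq g _ _.
      by apply: leq_trans r_big; apply: size_word_of.
    by apply: perm_eq_count => l; rewrite count_cat !count_word_of e addnC.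
  apply: (@act_inj _ _ p (word_of m)).
  rewrite -(split_word a) // => [|l|l]; last first.
  - by apply: leq_trans (ltnW (ha l)) (D_le l).
  - by rewrite /sel /c !ffunE /= /m; case: leqP => /=; lia.
  rewrite -(split_word b) // => l.
  - by rewrite /sel /c !ffunE /= /m; case: leqP => /=; lia.
  - by apply: leq_trans (ltnW (hb l)) (D_le l).
apply: leq_trans (subset_leq_card sub) _; apply: leq_trans (leq_imset_card _ _) _.
rewrite cardsT card_prod card_ffun card_bool card_ord card_dep_ffun.
by rewrite leq_mul2l foldrE big_map big_enum /=; apply/orP; right; under eq_bigr do rewrite card_ord.
Qed.

End Tiles.

(** * Covering by disjoint tiles *)

Section Patterns.
Variables (k B : nat).

Local Notation vec := {ffun 'I_k -> 'I_B.+1}.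

(** Patterns form a finite type independent of [X]. Box shapes that depend only on the pattern can
    thus be chosen before [X] and [p], with a uniform bound. *)
Definition pattern := {ffun vec * vec -> bool}.

Definition pattern_of (X : finType) (p : 'I_k -> {perm X}) (x : X) : pattern :=
  [ffun ab : vec * vec => act p (word_of (fun l => nat_of_ord (ab.1 l))) x ==
              act p (word_of (fun l => nat_of_ord (ab.2 l))) x].

Definition pattern_rel (S : pattern) (R : nat) (i : 'I_k) (c : nat) : bool :=
  (0 < c) && [exists ab : vec * vec, [&& [forall l : 'I_k, (ab.1 l <= R) && (ab.2 l <= R)],
    [forall l : 'I_k, (i < l) ==> (ab.1 l == ab.2 l)], ab.1 i == ab.2 i + c :> nat & S ab]].

Lemma pattern_rel_sound (X : finType) (p : 'I_k -> {perm X}) x R i c :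
  pattern_rel (pattern_of p x) R i c -> relation_at p x R i c.
Proof.
case/andP=> _ /existsP [[a b] /and4P [/forallP le /forallP gt /eqP ei]].
rewrite ffunE /= => /eqP e; exists (fun l => nat_of_ord (a l)), (fun l => nat_of_ord (b l)); split=> //.
  by move=> l; apply/andP; exact: le.
by move=> l il; have := gt l; rewrite il /= => /eqP ->.
Qed.

Lemma pattern_rel_complete (X : finType) (p : 'I_k -> {perm X}) x R i c :
  R <= B -> 0 < c -> relation_at p x R i c -> pattern_rel (pattern_of p x) R i c.
Proof.
move=> RB c0 [a [b [le gt ei e]]]; rewrite /pattern_rel c0 /=.
have aB l : a l < B.+1 by rewrite ltnS; apply: leq_trans (le l).1 RB.
have bB l : b l < B.+1 by rewrite ltnS; apply: leq_trans (le l).2 RB.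
apply/existsP; exists ([ffun l => Ordinal (aB l)], [ffun l => Ordinal (bB l)]).
apply/and4P; split.
- by apply/forallP => l; rewrite !ffunE /=; apply/andP; exact: le.
- by apply/forallP => l; apply/implyP => /gt el; rewrite !ffunE -val_eqE /= el.
- by rewrite !ffunE /= ei.
have same (w : 'I_k -> nat) (wB : forall l, w l < B.+1) :
    word_of (fun l => nat_of_ord ([ffun l => Ordinal (wB l)] l)) = word_of w.
  by rewrite /word_of; congr flatten; apply: eq_map => l; rewrite ffunE.
by rewrite ffunE /= !same e.
Qed.

(** Both patterns are carried to the common point [act p w x]: [w] and [w'] commute with the words
    compared and act injectively, so coincidences correspond. *)
Lemma pattern_of_eq (X : finType) (p : 'I_k -> {perm X}) x y r w w' :
  k * B + k * B <= r -> avoids p (noncomm p) r x -> avoids p (noncomm p) r y ->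
  size w <= k * B -> size w' <= k * B -> act p w x = act p w' y ->
  pattern_of p x = pattern_of p y.
Proof.
move=> r_big gx gy sw sw' e.
have swap z u (a : {ffun 'I_k -> 'I_B.+1}) : avoids p (noncomm p) r z -> size u <= k * B ->
    act p u (act p (word_of (fun l => nat_of_ord (a l))) z) =
    act p (word_of (fun l => nat_of_ord (a l))) (act p u z).
  move=> gz su; rewrite -!act_cat; apply: act_perm_eq gz _ _; last by rewrite perm_catC.
  rewrite size_cat; apply: leq_trans r_big; apply: leq_add su.
  by apply: size_word_of => l; rewrite -ltnS ltn_ord.
apply/ffunP => -[a b]; rewrite !ffunE /=.
by rewrite -(inj_eq (@act_inj _ _ p w)) -[in RHS](inj_eq (@act_inj _ _ p w')) !swap // e.
Qed.

End Patterns.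

Lemma tile_system (k e : nat) : exists B (Df : pattern k B -> 'I_k -> nat),
  (forall S l, 0 < Df S l <= B) /\
  forall (X : finType) (p : 'I_k -> {perm X}) x,
    avoids p (noncomm p) (k * B + k * B + B + 1) x ->
    exists (C : {set X}) (q : {ffun 'I_k -> {perm X}}),
    [/\ tile_of p (Df (pattern_of B p x)) x C, forall i j, commute (q i) (q j),
        forall j, perm_on C (q j)
      & e * #|[set z in C | [exists j, q j z != p j z]]| <= #|C|].
Proof.
(* The term [e * chart_const k R k] brings the mismatch proportion [chart_const k R k / N R] below
   [1/e]; the final 1 keeps [N R] positive. *)
pose N R := R + e * chart_const k R k + 1.
have [B hB] := stable_scale k N; exists B.
have /fin_all_exists [Df hDf] : forall S : pattern k B, exists D : 'I_k -> nat, exists R,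
    [/\ N R <= B, forall l, 0 < D l <= N R, forall l, D l = N R \/ pattern_rel S R l (D l)
      & forall l c, c < D l -> ~~ pattern_rel S (N R) l c].
  move=> S; have [|R i c||R [RB [d hd]]] := hB (pattern_rel S).
  - move=> R R' i c le /andP [c0 /existsP [ab /and4P [/forallP h1 h2 h3 h4]]].
    apply/andP; split=> //; apply/existsP; exists ab; apply/and4P; split=> //.
    apply/forallP => l; have /andP [la lb] := h1 l.
    by rewrite (leq_trans la le) (leq_trans lb le).
  - case/andP=> c0 /existsP [ab /and4P [/forallP /(_ i) /andP [h1 _] _ /eqP h3 _]].
    by rewrite c0 /=; apply: leq_trans h1; rewrite h3 leq_addl.
  - by move=> R; rewrite /N -addnA leq_addr.
  (* The default [N R] is the side length at a coordinate without relation. *)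
  exists (fun l => odflt (N R) (d l)), R; split=> // [l|l|l c].
  - have := hd l; case: (d l) => [c|] /=; last by rewrite leqnn /N addn1.
    case=> /andP [c0 /existsP [ab /and4P [/forallP /(_ l) /andP [h1 _] _ /eqP h3 _]]] _.
    rewrite c0 /=; apply: leq_trans (leq_addl (ab.2 l) c) _; rewrite -h3.
    by apply: leq_trans h1 _; rewrite /N -addnA leq_addr.
  - by have := hd l; case: (d l) => [c [? _]|] /=; [right | left].
  - by have := hd l; case: (d l) => [c' [_ h]|h _] /=; [exact: h | exact: h].
exists Df; split=> [S l|X p x x_good].
  have [R [RB hD _ _]] := hDf S; have /andP [-> h] := hD l.
  exact: leq_trans h RB.
have [R [RB hD hrel hmin]] := hDf (pattern_of B p x).
have RN : R <= N R by rewrite /N -addnA leq_addr.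
have [||||C [q [hC qc qon mis]]] := @tile_exists k X p (Df (pattern_of B p x)) R (N R) _ x x_good.
- by rewrite leq_add2r !leq_add ?leq_mul // (leq_trans RN RB).
- exact: hD.
- by move=> l; have [->|/pattern_rel_sound] := hrel l; [left | right].
- move=> l c /andP [c0 /hmin /negP h] /(pattern_rel_complete RB c0) //.
exists C, q; split=> //; set m := #|_| in mis *.
have K0 : 0 < chart_const k R k by case: (k) => //= k'; rewrite addn1.
rewrite -(leq_pmul2l K0); apply: leq_trans mis.
by rewrite mulnA leq_mul2r /N; apply/orP; right; lia.
Qed.

(** By maximality every tile meets a chosen one. Base points of meeting tiles have the same pattern,
    hence tiles of the same shape, and [card_meeting] bounds the base points charged to a chosen
    tile by [2 ^ k] times its size. *)
Lemma vitali_family (k B : nat) (Df : pattern k B -> 'I_k -> nat) (X : finType)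
    (p : 'I_k -> {perm X}) (r : nat) (X' : {set X}) (tile : X -> {set X}) :
  k * B + k * B <= r -> (forall S l, 0 < Df S l <= B) ->
  {in X', forall x, avoids p (noncomm p) r x /\ tile_of p (Df (pattern_of B p x)) x (tile x)} ->
  exists Y : {set X}, [/\ Y \subset X',
    {in Y &, forall y y', y != y' -> [disjoint tile y & tile y']}
    & #|X'| <= 2 ^ k * \sum_(y in Y) #|tile y|].
Proof.
move=> r_big Df_bnd hX'.
pose P (Y : {set X}) := (Y \subset X') &&
  [forall y in Y, forall y' in Y, (y != y') ==> [disjoint tile y & tile y']].
have P0 : P set0.
  by rewrite /P sub0set /=; apply/forall_inP => y; rewrite inE.
have [Y /maxsetP [/andP [sY /forall_inP disjY] maxY] _] := maxset_exists P0.
have disj : {in Y &, forall y y', y != y' -> [disjoint tile y & tile y']}.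
  by move=> y y' yY y'Y ne; have /forall_inP /(_ _ y'Y) := disjY y yY; rewrite ne.
exists Y; split=> //.
pose meet y := [set x in X' | ~~ [disjoint tile x & tile y]].
have tile_ne x : x \in X' -> ~~ [disjoint tile x & tile x].
  move=> /hX' [_ [cardT _]]; rewrite -setI_eq0 setIid -card_gt0 cardT.
  by apply: prodn_gt0 => l; have /andP [] := Df_bnd (pattern_of B p x) l.
have sub : X' \subset \bigcup_(y in Y) meet y.
  apply/subsetP => x xX'; case: (boolP (x \in Y)) => xY.
    by apply/bigcupP; exists x => //; rewrite inE xX' tile_ne.
  apply/bigcupP; case: (boolP [exists y in Y, ~~ [disjoint tile x & tile y]]).
    by case/exists_inP=> y yY h; exists y => //; rewrite inE xX'.
  move=> /exists_inPn h; case/negP: xY.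
  rewrite -(maxY (x |: Y)) ?setU11 ?subsetUr //.
  apply/andP; split; first by rewrite subUset sub1set xX'.
  apply/forall_inP => y; rewrite !inE => hy; apply/forall_inP => y'; rewrite !inE => hy'.
  apply/implyP => ne; case/orP: hy hy' => [/eqP ey|yY] /orP [/eqP ey'|y'Y].
  - by rewrite ey ey' eqxx in ne.
  - by rewrite ey; have := h y' y'Y; rewrite negbK.
  - by rewrite ey' disjoint_sym; have := h y yY; rewrite negbK.
  - exact: disj.
apply: leq_trans (subset_leq_card sub) _.
have : #|\bigcup_(y in Y) meet y| <= \sum_(y in Y) #|meet y|.
  elim/big_ind2: _ => [|A a A' a' hA hA'|//]; first by rewrite cards0.
  by apply: leq_trans (leq_card_setU _ _).1 (leq_add hA hA').
move/leq_trans; apply; rewrite big_distrr leq_sum //= => y yY.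
have [y_good [-> y_tile]] := hX' y (subsetP sY y yY).
have D_le S l : Df S l <= B by have /andP [] := Df_bnd S l.
have sz S (a : 'I_k -> nat) : (forall l, a l < Df S l) -> size (word_of a) <= k * B.
  by move=> ha; apply: size_word_of => l; apply: leq_trans (ltnW (ha l)) (D_le _ _).
apply: (card_meeting (N := B) (r := r) (y := y) (p := p)) => //.
  by apply: leq_trans r_big; rewrite leq_addr.
move=> x; rewrite inE => /andP [xX' meet_xy].
have [x_good [_ x_tile]] := hX' x xX'; split=> //.
move: meet_xy; rewrite -setI_eq0 => /set0Pn [z]; rewrite inE => /andP [].
move=> /x_tile [a [ha ->]] /y_tile [b [hb eq_ab]].
have eS : pattern_of B p x = pattern_of B p y.
  exact: (pattern_of_eq r_big x_good y_good (sz _ _ ha) (sz _ _ hb) eq_ab).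
by exists a, b; split=> //; rewrite -eS.
Qed.

(** * Exhaustion through finitely many scales *)

(** This bounds the orbits of the group generated by the [q j], as the correction of signs
    requires. *)
Definition bounded_blocks (k : nat) (X : finType) (M : nat) (q : 'I_k -> {perm X}) : Prop :=
  forall z, exists C : {set X}, [/\ z \in C, #|C| <= M & forall j y, y \in C -> q j y \in C].

Definition disagreement (k : nat) (X : finType) (U : {set X}) (p q : 'I_k -> {perm X}) : {set X} :=
  [set z in U | [exists j, q j z != p j z]].

Definition partial_solution (k : nat) (X : finType) (p : 'I_k -> {perm X}) (e M : nat)
    (U : {set X}) (q : 'I_k -> {perm X}) : Prop :=
  [/\ forall i j, commute (q i) (q j), forall j, perm_on U (q j),
      e * #|disagreement U p q| <= #|X| & bounded_blocks M q].

(* m counts the scales used so far: while U misses more than a proportion 1/h of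
   the points, each scale adds at least a proportion 1/(2^(k+1) h). *)
Definition coverable (k h m : nat) : Prop :=
  forall e, exists d M, forall (X : finType) (p : 'I_k -> {perm X}),
    d * #|noncomm p| <= #|X| ->
    exists (U : {set X}) (q : 'I_k -> {perm X}), partial_solution p e M U q /\
      (h * #|~: U| <= #|X| \/ m * #|X| <= 2 ^ k.+1 * h * #|U|).

Lemma card_bigcup_le (I X : finType) (Y : {set I}) (F : I -> {set X}) :
  #|\bigcup_(y in Y) F y| <= \sum_(y in Y) #|F y|.
Proof.
elim/big_ind2: _ => [|A a A' a' hA hA'|//]; first by rewrite cards0.
by apply: leq_trans (leq_card_setU _ _).1 (leq_add hA hA').
Qed.

Lemma card_bigcup_disjoint (I X : finType) (Y : {set I}) (F : I -> {set X}) :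
  {in Y &, forall y y', y != y' -> [disjoint F y & F y']} ->
  #|\bigcup_(y in Y) F y| = \sum_(y in Y) #|F y|.
Proof.
move=> disj; rewrite -sum1_card; under [RHS]eq_bigr do rewrite -sum1_card.
rewrite (exchange_big_dep (mem (\bigcup_(y in Y) F y))) /=; last first.
  by move=> y z yY zy; apply/bigcupP; exists y.
apply: eq_bigr => z /bigcupP [y yY zy]; rewrite (bigD1 y) ?yY //= big1 // => y'.
case/andP=> /andP [y'Y zy'] ne; have := disj _ _ y'Y yY ne.
by rewrite disjoint_subset => /subsetP /(_ _ zy'); rewrite inE zy.
Qed.

Definition entrance (k : nat) (X : finType) (p : 'I_k -> {perm X}) (U : {set X}) : {set X} :=
  [set z in ~: U | [exists j, p j z \in U]].

(* As many points enter U under p j as leave it, and q j does not leave U. *)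
Lemma card_entrance (k : nat) (X : finType) (p q : 'I_k -> {perm X}) (U : {set X}) :
  (forall j, perm_on U (q j)) ->
  #|entrance p U| <= k * #|disagreement U p q|.
Proof.
move=> q_on.
have sub : entrance p U \subset \bigcup_(j in [set: 'I_k]) ((p j @^-1: U) :\: U).
  apply/subsetP => z; rewrite !inE => /andP [zU /existsP [j hj]].
  by apply/bigcupP; exists j => //; rewrite !inE zU.
apply: leq_trans (subset_leq_card sub) _.
apply: leq_trans (card_bigcup_le _ _) _.
rewrite -[X in X * _](card_ord k) -cardsT -sum_nat_const; apply: leq_sum => j _.
have cpre : #|p j @^-1: U| = #|U|.
  by rewrite on_card_preimset //; exists (p j)^-1%g => y _; rewrite ?permK ?permKV.
have -> : #|(p j @^-1: U) :\: U| = #|U :\: (p j @^-1: U)|.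
  have := cardsID U (p j @^-1: U); have := cardsID (p j @^-1: U) U.
  by rewrite cpre setIC; lia.
apply: subset_leq_card; apply/subsetP => z; rewrite !inE => /andP [h zU].
rewrite zU; apply/existsP; exists j; apply: contra h => /eqP <-.
by rewrite (perm_closed _ (q_on j)).
Qed.

(** This keeps the tiles of the next scale disjoint from the region already filled. *)
Lemma avoids_entrance (k : nat) (X : finType) (p : 'I_k -> {perm X}) (U Z : {set X}) r x w :
  entrance p U \subset Z -> avoids p Z r x -> x \notin U -> size w <= r ->
  act p w x \notin U.
Proof.
move=> /subsetP sZ; elim: w r x => [|i w IH] [|r] x //= /andP [xZ /forallP av] xU sw.
apply: IH (av i) _ sw; apply: contra xZ => h; apply: sZ.
by rewrite !inE xU; apply/existsP; exists i.
Qed.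

Lemma coverable_step (k h m : nat) : coverable k h m -> coverable k h m.+1.
Proof.
move=> cov e; have [B [Df [Df_bnd hDf]]] := tile_system k (2 * e).
pose r := k * B + k * B + B + 1; pose c := k.+1 ^ r.
(* Half of the error [1/e] is left to the new tiles. The term [4 * h * c * k], with [4 * h * c]
   added to [d] below, ensures that at most a proportion [1/(2h)] of the points reach [noncomm] or
   the entrance of [U] within [r] steps. *)
have [d [M hM]] := cov (2 * e + 4 * h * c * k).
exists (d + 4 * h * c), (M + B ^ k + 1) => X p hd.
have [|U [q [[q_comm q_on q_dis q_blk] hU]]] := hM X p; first by lia.
have dis2 : 2 * e * #|disagreement U p q| <= #|X| by lia.
case: (leqP (h * #|~: U|) #|X|) => [small|big].
  exists U, q; split; last by left.
  split=> //; first by lia.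
  by move=> z; have [C [zC cC hC]] := q_blk z; exists C; split=> //; lia.
have {hU} hU : m * #|X| <= 2 ^ k.+1 * h * #|U| by case: hU => // ?; lia.
pose Z := noncomm p :|: entrance p U.
pose X' := [set x in ~: U | avoids p Z r x].
have good x : x \in X' -> avoids p (noncomm p) r x.
  by rewrite inE => /andP [_]; apply: avoidsS; exact: subsetUl.
have /fin_all_exists [Cq hCq] : forall x : X, exists Cq : {set X} * {ffun 'I_k -> {perm X}},
    x \in X' -> [/\ tile_of p (Df (pattern_of B p x)) x Cq.1,
      forall i j, commute (Cq.2 i) (Cq.2 j), forall j, perm_on Cq.1 (Cq.2 j)
      & 2 * e * #|disagreement Cq.1 p Cq.2| <= #|Cq.1|].
  move=> x; case: (boolP (x \in X')) => [/good /hDf [C [s hs]]|_]; last by exists (set0, [ffun => 1%g]).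
  by exists (C, s).
pose tile x := (Cq x).1.
have [||Y [sY disjY cardX']] := @vitali_family k B Df X p r X' tile _ Df_bnd.
- by rewrite /r -addnA leq_addr.
- by move=> x xX'; split; [exact: good | have [] := hCq x xX'].
have tileU x : x \in Y -> [disjoint tile x & U].
  move=> /(subsetP sY) xX'; have [[_ ht] _ _ _] := hCq x xX'.
  rewrite disjoint_subset; apply/subsetP => z /ht [a [ha ->]]; rewrite inE.
  move: xX'; rewrite !inE => /andP [xU av].
  apply: avoids_entrance av xU _; first exact: subsetUr.
  apply: (@leq_trans (k * B)); last by rewrite /r -!addnA leq_addr.
  apply: size_word_of => l; apply: leq_trans (ltnW (ha l)) _.
  by have /andP [] := Df_bnd (pattern_of B p x) l.
(* [None] indexes the region already filled and [Some y] the new tile at [y], so that one gluing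
   handles both. *)
pose YY := None |: [set Some y | y in Y].
pose tl o := if o is Some y then tile y else U.
pose qq o := if o is Some y then fun j => (Cq y).2 j else q.
have inYY (P : option X -> Prop) : P None -> {in Y, forall y, P (Some y)} -> {in YY, forall o, P o}.
  by move=> PN PY o /setU1P [->|/imsetP [y yY ->]] //; exact: PY.
have [||| Q [Q_comm Q_in Q_out]] := @glue_perms k _ X YY tl qq.
- move=> o o' oY o'Y; move: o oY; apply: (inYY) => [|y yY]; move: o' o'Y; apply: inYY => [|y' y'Y] //= ne.
  + by rewrite disjoint_sym; apply: tileU.
  + exact: tileU.
  + exact: disjY.
- by apply: inYY => [|y yY] j //=; have [_ _ -> _] := hCq y (subsetP sY y yY).
- by apply: inYY => [|y yY] i j //=; have [_ hc _ _] := hCq y (subsetP sY y yY); apply: hc.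
have NY : None \in YY by rewrite setU11.
have SY y : y \in Y -> Some y \in YY by move=> yY; rewrite inE imset_f ?orbT.
pose W := \bigcup_(y in Y) tile y; pose U' := U :|: W.
have cardW : #|W| = \sum_(y in Y) #|tile y| by apply: card_bigcup_disjoint.
have disUW : [disjoint U & W].
  by apply: bigcup_disjoint => y yY; rewrite disjoint_sym tileU.
have cardU' : #|U'| = #|U| + #|W|.
  by apply/eqP; rewrite (leq_card_setU U W).2.
exists U', Q; split; last first.
  (* More than [1/h] of the points lie outside [U] and at most [1/(2h)] fail to avoid [Z]. So [X']
     has proportion more than [1/(2h)], and the new tiles fill at least [2^-k] times that. *)
  right; have cardZ : #|[set x | ~~ avoids p Z r x]| <= c * #|Z| := card_not_avoids p Z r.
  have Z_le : #|Z| <= #|noncomm p| + k * #|disagreement U p q|.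
    apply: leq_trans (leq_card_setU _ _).1 _.
    by rewrite leq_add2l; apply: card_entrance.
  have V_le : #|~: U| <= #|X'| + #|[set x | ~~ avoids p Z r x]|.
    apply: leq_trans (leq_card_setU _ _).1; apply: subset_leq_card; apply/subsetP => x.
    by rewrite !inE => ->; case: (avoids _ _ _ _).
  have h1 : 2 * h * #|[set x | ~~ avoids p Z r x]| <= #|X|.
    move: cardZ Z_le q_dis hd; move: #|[set x | _]| #|Z| #|noncomm p| #|disagreement _ _ _| #|X| => a z n t X0 h1 h2 h3 h4.
    have h5 : a <= c * n + c * (k * t) by rewrite -mulnDr (leq_trans h1) // leq_mul2l h2 orbT.
    have h6 : 2 * h * a <= 2 * h * (c * n + c * (k * t)) by rewrite leq_mul2l h5 orbT.
    have h7 : 4 * h * c * n <= X0 by apply: leq_trans h4; rewrite mulnDl leq_addl.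
    have h8 : 4 * h * c * k * t <= X0 by apply: leq_trans h3; rewrite mulnDl leq_addl.
    by rewrite -(leq_pmul2l (isT : 0 < 2)); lia.
  rewrite -cardW in cardX'; rewrite cardU' mulnDr mulSn addnC leq_add //.
  have h2 : 2 * h * #|X'| <= 2 * h * (2 ^ k * #|W|) by rewrite leq_mul2l cardX' orbT.
  have h3 : 2 * h * #|~: U| <= 2 * h * (#|X'| + #|[set x | ~~ avoids p Z r x]|).
    by rewrite leq_mul2l V_le orbT.
  rewrite expnS; move: h1 h2 h3 big; move: (2 ^ k) #|X| #|~: U| #|X'| #|W| #|[set x | _]| => a b u v w z; lia.
split=> //.
- move=> j; apply/subsetP => z; rewrite inE; apply: contraR => zU'.
  rewrite Q_out //; apply: inYY => [|y yY] /=; apply: contra zU' => hz.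
    by rewrite inE hz.
  by rewrite inE; apply/orP; right; apply/bigcupP; exists y.
- have sub : disagreement U' p Q \subset disagreement U p q :|:
      \bigcup_(y in Y) disagreement (tile y) p (Cq y).2.
    apply/subsetP => z; rewrite !inE => /andP [/orP [zU|/bigcupP [y yY zy]] ex].
      rewrite zU; apply/orP; left; case/existsP: ex => j; rewrite (Q_in _ NY j z zU) => ne.
      by apply/existsP; exists j.
    apply/orP; right; apply/bigcupP; exists y => //; rewrite inE zy.
    case/existsP: ex => j; rewrite (Q_in _ (SY y yY) j z zy) => ne.
    by apply/existsP; exists j.
  have h1 : #|disagreement U' p Q| <= #|disagreement U p q| +
      \sum_(y in Y) #|disagreement (tile y) p (Cq y).2|.
    apply: leq_trans (subset_leq_card sub) _; apply: leq_trans (leq_card_setU _ _).1 _.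
    by rewrite leq_add2l card_bigcup_le.
  have h2 : 2 * e * \sum_(y in Y) #|disagreement (tile y) p (Cq y).2| <= #|X|.
    apply: leq_trans (max_card (mem W)); rewrite cardW big_distrr leq_sum //= => y yY.
    by have [] := hCq y (subsetP sY y yY).
  move: dis2 h1 h2; move: #|X| #|disagreement U' p Q| #|disagreement U p q| (\sum_(y in Y) _) => a b f g h1 h2 h3.
  have : 2 * e * b <= 2 * e * (f + g) by rewrite leq_mul2l h2 orbT.
  lia.
- move=> z; case: (boolP (z \in U)) => zU.
    (* The old block is cut down to [U], where [Q] agrees with [q]. *)
    have [C [zC cC hC]] := q_blk z; exists (C :&: U); split; first by rewrite inE zC.
      by apply: leq_trans (subset_leq_card (subsetIl _ _)) _; lia.
    move=> j y; rewrite inE => /andP [yC yU].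
    by rewrite (Q_in _ NY j y yU) inE /= hC // (perm_closed _ (q_on j)).
  case: (boolP (z \in W)) => [/bigcupP [y yY zy]|zW].
    have [[cT _] _ on_y _] := hCq y (subsetP sY y yY).
    exists (tile y); split=> // [|j y' hy'].
      rewrite [#|_|]cT; apply: (@leq_trans (B ^ k)); last by lia.
      rewrite -[X in _ ^ X]card_ord -prod_nat_const; apply: leq_prod => l _.
      by have /andP [] := Df_bnd (pattern_of B p y) l.
    by rewrite (Q_in _ (SY y yY) j y' hy') /= (perm_closed _ (on_y j)).
  exists [set z]; split; rewrite ?set11 ?cards1 //; first by lia.
  move=> j y; rewrite !inE => /eqP ->; rewrite Q_out //.
  by apply: inYY => [|y' y'Y] //=; apply: contra zW => hz; apply/bigcupP; exists y'.
Qed.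

Theorem stability_bounded (k h : nat) : exists d M,
  forall (X : finType) (p : 'I_k -> {perm X}), d * #|noncomm p| <= #|X| ->
  exists q : 'I_k -> {perm X}, [/\ forall i j, commute (q i) (q j), bounded_blocks M q
    & forall j, h * #|[set x | q j x != p j x]| <= #|X|].
Proof.
have cov m : coverable k (2 * h) m.
  elim: m => [|m IH]; last exact: coverable_step.
  move=> e; exists 0, 1 => X p _; exists set0, (fun _ => 1%g); split; last by right.
  split=> [i j|j||z].
  - exact: commute1.
  - exact: perm_on1.
  - rewrite (_ : disagreement _ _ _ = set0) ?cards0 ?muln0 //.
    by apply/setP => z; rewrite !inE.
  by exists [set z]; split; rewrite ?set11 ?cards1 // => j y; rewrite !inE perm1.
(* With this many scales, for [h > 0], the second alternative of [coverable] forces [U] to be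
   everything. Either way the complement of [U] has proportion at most [1/(2h)], and so has the
   disagreement on [U]. *)
have [d [M hM]] := cov (2 ^ k.+1 * (2 * h)) (2 * h); exists d, M => X p /hM.
case=> U [q [[q_comm q_on q_dis q_blk] hU]]; exists q; split=> // j.
have V_le : 2 * h * #|~: U| <= #|X|.
  case: (posnP h) => [->|h0]; first by rewrite muln0.
  case: hU => //; rewrite leq_pmul2l; last by rewrite !muln_gt0 expn_gt0 h0.
  by have := cardsC U => cU leU; rewrite (_ : #|~: U| = 0) ?muln0 //; lia.
have sub : [set x | q j x != p j x] \subset disagreement U p q :|: ~: U.
  apply/subsetP => x; rewrite !inE => ne; case: (x \in U) => //=.
  by rewrite orbF; apply/existsP; exists j.
have := subset_leq_card sub; have := (leq_card_setU (disagreement U p q) (~: U)).1.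
move: V_le q_dis; move: #|X| #|~: U| #|disagreement U p q| #|_ :|: _| #|[set x | _]| => a b c f g; nia.
Qed.

(** * Even permutations *)

Section EvenCorrection.
Variables (k M : nat) (X : finType) (q : 'I_k -> {perm X}).

Lemma restr_permU (S S' : {set X}) (s : {perm X}) : [disjoint S & S'] ->
  s \in ('N(S | 'P))%g -> s \in ('N(S' | 'P))%g ->
  restr_perm (S :|: S') s = (restr_perm S s * restr_perm S' s)%g.
Proof.
move=> dis nS nS'; have nU : s \in ('N(S :|: S' | 'P))%g.
  apply/astabsP => x; have /astabsP h := nS; have /astabsP h' := nS'.
  by rewrite !inE h h'.
apply/permP => x; rewrite permM.
have out (V : {set X}) y : y \notin V -> restr_perm V s y = y.
  exact: out_perm (restr_perm_on V s).
have inV (V : {set X}) y : y \in V -> restr_perm V s y \in V.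
  by move=> yV; rewrite (perm_closed _ (restr_perm_on V s)).
case: (boolP (x \in S)) => xS.
  rewrite (restr_permE nU) ?inE ?xS // (out S'); first by rewrite (restr_permE nS).
  have := inV S x xS; move: dis; rewrite disjoint_subset => /subsetP h /h.
  by rewrite inE.
rewrite (out S) //; case: (boolP (x \in S')) => xS'.
  by rewrite (restr_permE nU) ?inE ?xS' ?orbT // (restr_permE nS').
by rewrite !out // inE negb_or xS.
Qed.

Hypotheses (q_comm : forall i j, commute (q i) (q j)) (q_blk : bounded_blocks M q).

Let G := <<[set q j | j : 'I_k]>>%G.

(** [W] is a minimal invariant set on which the restrictions have the signs of the [q j]. By
    minimality distinct orbits in [W] have distinct sign vectors, so there are at most [2 ^ k] of
    them, each of size at most [M]. Making the action trivial on [W] removes exactly the sign of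
    each [q j]. *)
Lemma even_correction : exists q' : 'I_k -> {perm X},
  [/\ forall i j, commute (q' i) (q' j), forall j, odd_perm (q' j) = false
    & forall j, #|[set x | q' j x != q j x]| <= 2 ^ k * M].
Proof.
have qG j : q j \in G by apply/mem_gen/imset_f.
have actsq (V : {set X}) : [acts G, on V | 'P] -> forall j, q j \in ('N(V | 'P))%g.
  by move=> h j; apply: (subsetP h); apply: qG.
pose P (V : {set X}) := [acts G, on V | 'P] &&
  [forall j, odd_perm (restr_perm V (q j)) == odd_perm (q j)].
have PT : P setT.
  have nT : [acts G, on setT | 'P].
    by apply/subsetP => s _; apply/astabsP => x; rewrite !inE.
  apply/andP; split=> //; apply/forallP => j; apply/eqP; congr odd_perm.
  by apply/permP => x; rewrite (restr_permE (actsq _ nT j)) ?inE.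
have [W /minsetP [/andP [actW /forallP oddW] minW] _] := minset_exists PT.
pose orbs := [set orbit 'P%act G x | x in W].
have orbP V : V \in orbs -> [/\ [acts G, on V | 'P], V \subset W, V != set0 & #|V| <= M].
  case/imsetP=> x xW ->; split.
  - by apply: acts_orbit; apply: subsetT.
  - by rewrite acts_sub_orbit.
  - by apply/set0Pn; exists x; apply: orbit_refl.
  have [C [xC cC hC]] := q_blk x; apply: leq_trans cC; apply: subset_leq_card.
  rewrite acts_sub_orbit // gen_subG; apply/subsetP => s /imsetP [j _ ->].
  by rewrite !inE /=; apply/subsetP => y yC; rewrite inE; apply: hC.
have part := orbit_partition actW; have /and3P [_ /trivIsetP triv _] := part.
pose chi (V : {set X}) : {ffun 'I_k -> bool} := [ffun j => odd_perm (restr_perm V (q j))].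
have chi_inj : {in orbs &, injective chi}.
  move=> V V' hV hV' e; apply/eqP; apply: contraT => ne.
  have dis : [disjoint V & V'] := triv V V' hV hV' ne.
  have [aV sV nV _] := orbP V hV; have [aV' sV' _ _] := orbP V' hV'.
  have aU : [acts G, on V :|: V' | 'P] by apply: actsU.
  have aD : [acts G, on W :\: (V :|: V') | 'P] by apply: actsD.
  have sU : V :|: V' \subset W by rewrite subUset sV.
  have WE : W = (W :\: (V :|: V')) :|: (V :|: V').
    by rewrite setUC -{1}(setID W (V :|: V')) (setIidPr sU).
  (* Two orbits with the same signs can be removed together. *)
  have PD : P (W :\: (V :|: V')).
    apply/andP; split=> //; apply/forallP => j; rewrite -(eqP (oddW j)) {2}WE.
    rewrite restr_permU; [|by rewrite disjoints_subset setDE subsetIr| exact: actsq..].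
    rewrite restr_permU; [| by []| exact: actsq..].
    have /ffunP /(_ j) := e; rewrite !ffunE !odd_permM => ->.
    by rewrite addbb addbF.
  have WD : W :\: (V :|: V') = W by apply: minW => //; apply: subsetDl.
  have /set0Pn [x xV] := nV.
  by have := subsetP sV x xV; rewrite -WD !inE xV.
have cardW : #|W| <= 2 ^ k * M.
  rewrite (card_partition part); apply: (@leq_trans (\sum_(V in orbs) M)).
    by apply: leq_sum => V /orbP [].
  rewrite sum_nat_const leq_mul2r -(card_in_imset chi_inj).
  by apply/orP; right; apply: leq_trans (max_card _) _; rewrite card_ffun card_bool card_ord.
have nC j : q j \in ('N(~: W | 'P))%g by rewrite astabsC actsq.
exists (fun j => restr_perm (~: W) (q j)); split.
- by move=> i j; rewrite /commute -!morphM ?nC // q_comm.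
- move=> j; have := @restr_permU W (~: W) (q j).
  rewrite setUCr => /(_ _ (actsq _ actW j) (nC j)) e.
  have {}e : q j = (restr_perm W (q j) * restr_perm (~: W) (q j))%g.
    rewrite -e; last by rewrite disjoints_subset setCK.
    by apply/permP => x; rewrite (restr_permE (actsq _ (andP PT).1 j)) ?inE.
  have := congr1 (@odd_perm X) e; rewrite odd_permM (eqP (oddW j)).
  by case: (odd_perm (q j)); case: (odd_perm _).
- move=> j; apply: leq_trans cardW; apply: subset_leq_card; apply/subsetP => x.
  by rewrite inE; apply: contraR => xW; rewrite (restr_permE (nC j)) ?inE.
Qed.
End EvenCorrection.

(** * From commutators and Hamming distances to counting *)

Definition moved (X : finType) (s : {perm X}) : {set X} := [set x | s x != x].

Lemma card_noncomm (k c : nat) (X : finType) (p : 'I_k -> {perm X}) :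
  (forall i j : 'I_k, i < j -> #|moved (p i * p j * (p i)^-1 * (p j)^-1)| <= c) ->
  #|noncomm p| <= k * k * c.
Proof.
move=> hc.
pose F (ij : 'I_k * 'I_k) := 
  if ij.1 < ij.2 then moved (p ij.1 * p ij.2 * (p ij.1)^-1 * (p ij.2)^-1)%g else set0.
have mem_F (i j : 'I_k) x : i < j -> p i (p j x) != p j (p i x) -> x \in \bigcup_(ij in setT) F ij.
  move=> ij ne; apply/bigcupP; exists (i, j) => //; rewrite /F /= ij inE.
  by apply: contra ne => /eqP; rewrite !permM => e; apply/eqP; rewrite -{1}e !permKV.
have sub : noncomm p \subset \bigcup_(ij in setT) F ij.
  apply/subsetP => x; rewrite inE => /existsP [i /existsP [j ne]].
  case: (ltngtP i j) => [ij|ji|/val_inj e]; first exact: mem_F ne.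
    by apply: mem_F ji _; rewrite eq_sym.
  by rewrite e eqxx in ne.
apply: leq_trans (subset_leq_card sub) _; apply: leq_trans (card_bigcup_le _ _) _.
have <- : #|[set: 'I_k * 'I_k]| = k * k by rewrite cardsT card_prod card_ord.
rewrite -sum_nat_const; apply: leq_sum => -[i j] _; rewrite /F /=.
by case: ifP => [/hc //|_]; rewrite cards0.
Qed.

Lemma near_commuting (k h : nat) : exists D, forall (n : nat) (p : 'I_k -> 'S_n),
  (forall i j : 'I_k, i < j -> D.+1 * #|moved (p i * p j * (p i)^-1 * (p j)^-1)| < n) ->
  exists q : 'I_k -> 'S_n, (forall i j, commute (q i) (q j)) /\
    forall j, h * #|[set x | p j x != q j x]| <= n.
Proof.
(* The factor [k * k] absorbs the sum over pairs of generators in [card_noncomm]. *)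
have [d [M hM]] := stability_bounded k h; exists (d * (k * k)) => n p hp.
have [|q [q_comm _ q_near]] := hM _ p.
  have le : #|noncomm p| <= k * k * (n %/ (d * (k * k)).+1).
    apply: card_noncomm => i j ij; rewrite leq_divRL // mulnC.
    exact: ltnW (hp i j ij).
  rewrite card_ord; apply: leq_trans (leq_trunc_div n (d * (k * k)).+1).
  apply: leq_trans (leq_mul (leqnn d) le) _.
  by rewrite mulnA mulnC leq_mul2l leqnSn orbT.
exists q; split=> // j; have := q_near j; rewrite card_ord; apply: leq_trans.
by rewrite leq_mul2l subset_leq_card ?orbT //; apply/subsetP => x; rewrite !inE eq_sym.
Qed.

(** The tolerance [1/h] is split in two: one half for the commuting approximation, the other for the
    sign correction, whose at most [2 ^ k * M] points are a proportion at most [1/(2h)] once [n] is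
    large. *)
Lemma near_commuting_even (k h : nat) : exists D, forall (n : nat) (p : 'I_k -> 'S_n),
  (forall j, odd_perm (p j) = false) ->
  (forall i j : 'I_k, i < j -> D.+1 * #|moved (p i * p j * (p i)^-1 * (p j)^-1)| < n) ->
  exists q : 'I_k -> 'S_n, [/\ forall j, odd_perm (q j) = false,
    forall i j, commute (q i) (q j) & forall j, h * #|[set x | p j x != q j x]| <= n].
Proof.
have [d [M hM]] := stability_bounded k (2 * h).
(* For n < n0 the hypothesis forces exact commutation. *)
pose n0 := 2 * h * (2 ^ k * M).
exists (d * (k * k) + n0) => n p p_even hp.
have le : #|noncomm p| <= k * k * (n %/ (d * (k * k) + n0).+1).
  apply: card_noncomm => i j ij; rewrite leq_divRL // mulnC.
  exact: ltnW (hp i j ij).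
have := leq_trunc_div n (d * (k * k) + n0).+1.
set c := n %/ _ in le * => hc.
case: (leqP n0 n) => [big|small].
  have [|q [q_comm q_blk q_near]] := hM _ p.
    rewrite card_ord; apply: leq_trans hc; apply: leq_trans (leq_mul (leqnn d) le) _.
    by rewrite mulnA mulnC leq_mul2l; apply/orP; right; lia.
  have [q' [q'_comm q'_even q'_near]] := even_correction q_comm q_blk.
  exists q'; split=> // j; have := q_near j; have := q'_near j; rewrite card_ord.
  have sub : [set x | p j x != q' j x] \subset
      [set x | q' j x != q j x] :|: [set x | q j x != p j x].
    apply/subsetP => x; rewrite !inE -negb_and; apply: contra => /andP [/eqP -> /eqP ->].
    by [].
  have := leq_trans (subset_leq_card sub) (leq_card_setU _ _).1.
  move: big; rewrite /n0.
  move: #|[set x | p j x != q' j x]| #|[set x | q' j x != q j x]| #|[set x | q j x != p j x]| (2 ^ k * M) => a b f g.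
  move=> h1 h2 h3 h4.
  have h5 : 2 * h * a <= 2 * h * (b + f) by rewrite leq_mul2l h2 orbT.
  have h6 : 2 * h * b <= 2 * h * g by rewrite leq_mul2l h3 orbT.
  lia.
have c0 : c = 0.
  by case: c hc {le} => // c; rewrite mulSn; lia.
exists p; split=> // [i j|j]; last first.
  by rewrite (_ : [set _ | _] = set0) ?cards0 ?muln0 //; apply/setP => x; rewrite !inE eqxx.
apply/permP => x; rewrite !permM.
have : x \notin noncomm p.
  by move: le; rewrite c0 muln0 leqn0 cards_eq0 => /eqP ->; rewrite inE.
by rewrite inE negb_exists => /forallP /(_ j); rewrite negb_exists => /forallP /(_ i); rewrite negbK => /eqP.
Qed.

Import Order.TTheory GRing.Theory Num.Theory.
Local Open Scope ring_scope.

Lemma hamming_dist_small (R : realType) (n D : nat) (s : 'S_n) : (1 <= n)%N ->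
  hamming_dist R s 1%g < (D.+1)%:R^-1 -> (D.+1 * #|moved s| < n)%N.
Proof.
move=> n1; rewrite /hamming_dist ltr_pdivrMr ?ltr0n // mulrC ltr_pdivlMr ?ltr0n //.
rewrite -natrM ltr_nat mulnC; congr (_ * _ < _)%N; apply: eq_card => x.
by rewrite !inE perm1.
Qed.

Lemma hamming_dist_lt (R : realType) (n h : nat) (eps : R) (s t : 'S_n) : (1 <= n)%N ->
  0 < eps -> eps^-1 < h%:R -> (h * #|[set x | s x != t x]| <= n)%N -> hamming_dist R s t < eps.
Proof.
move=> n1 eps0 he le; rewrite /hamming_dist ltr_pdivrMr ?ltr0n //.
have h0 : 0 < h%:R :> R by apply: lt_trans he; rewrite invr_gt0.
rewrite -(ltr_pM2l h0); apply: (@le_lt_trans _ _ n%:R); first by rewrite -natrM ler_nat.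
rewrite mulrA ltr_pMl ?ltr0n //.
by rewrite -ltr_pdivrMr // mul1r.
Qed.

Theorem mainTheorem1 (R : realType) (k : nat) (hk : (2 <= k)%N) :
  (forall eps : R, 0 < eps ->
    exists delta : R, 0 < delta /\
      forall (n : nat) (p : 'I_k -> 'S_n), (1 <= n)%N ->
        (forall i j : 'I_k, (i < j)%N ->
          hamming_dist R (p i * p j * (p i)^-1 * (p j)^-1)%g 1%g < delta) ->
        exists q : 'I_k -> 'S_n,
          (forall i j : 'I_k, commute (q i) (q j)) /\
          (forall i : 'I_k, hamming_dist R (p i) (q i) < eps))
  /\
  (forall eps : R, 0 < eps ->
    exists delta : R, 0 < delta /\
      forall (n : nat) (p : 'I_k -> 'S_n), (1 <= n)%N ->
        (forall i : 'I_k, p i \in ('Alt_('I_n))%g) ->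
        (forall i j : 'I_k, (i < j)%N ->
          hamming_dist R (p i * p j * (p i)^-1 * (p j)^-1)%g 1%g < delta) ->
        exists q : 'I_k -> 'S_n,
          (forall i : 'I_k, q i \in ('Alt_('I_n))%g) /\
          (forall i j : 'I_k, commute (q i) (q j)) /\
          (forall i : 'I_k, hamming_dist R (p i) (q i) < eps)).
Proof.
split=> eps eps0.
(* For an integer [h > 1/eps], a count [m] with [h * m <= n] satisfies [m / n <= 1/h < eps]. *)
- have he : eps^-1 < (Num.bound eps^-1)%:R.
    by apply: archi_boundP; rewrite invr_ge0 ltW.
  have [D hD] := near_commuting k (Num.bound eps^-1).
  exists (D.+1)%:R^-1; split=> [|n p n1 hp]; first by rewrite invr_gt0 ltr0n.
  have [i j ij|q [q_comm q_near]] := hD n p; first exact: hamming_dist_small (hp i j ij).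
  by exists q; split=> // i; apply: hamming_dist_lt he (q_near i).
- have he : eps^-1 < (Num.bound eps^-1)%:R.
    by apply: archi_boundP; rewrite invr_ge0 ltW.
  have [D hD] := near_commuting_even k (Num.bound eps^-1).
  exists (D.+1)%:R^-1; split=> [|n p n1 p_even hp]; first by rewrite invr_gt0 ltr0n.
  have [j|i j ij|q [q_even q_comm q_near]] := hD n p.
  + by have := p_even j; rewrite Alt_even => /negbTE.
  + exact: hamming_dist_small (hp i j ij).
  exists q; split=> [i|]; first by rewrite Alt_even; apply/negbT.
  by split=> // i; apply: hamming_dist_lt he (q_near i).
Qed.
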